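(* Let $\mathcal{U}$ be a metrically Ramsey ultrafilter on $\mathbb{N}$ and let $f:\mathbb{N}\to\mathbb{N}$ be a mapping such that $f(x)>x$ for each $x\in\mathbb{N}$. Then there exists a member $U\in\mathcal{U}$ having no subsets of the form $\{a,a+x,a+f(x)\}$ with $a,x\in\mathbb{N}$. In particular (taking $f(x)=2x$), for every metrically Ramsey ultrafilter $\mathcal{U}$ on $\mathbb{N}$, some member of $\mathcal{U}$ has no arithmetic progressions of length $2$, i.e. no subsets of the form $\{a,a+x,a+2x\}$ with $a,x\in\mathbb{N}$.
   Context: $\mathbb{N}=\{1,2,3,\dots\}$ is endowed with the metric $d(x,y)=|x-y|$. $[\mathbb{N}]^2$ denotes the set of all two-element subsets of $\mathbb{N}$. A mapping $\chi:[\mathbb{N}]^2\to\{0,1\}$ is an isometric coloring if $|x-y|=|z-t|$ implies $\chi(\{x,y\})=\chi(\{z,t\})$ for all $\{x,y\},\{z,t\}\in[\mathbb{N}]^2$. For $U\subseteq\mathbb{N}$, the set $[U]^2$ is $\chi$-monochrome if $\chi$ is constant on $[U]^2$. A free (i.e. non-principal) ultrafilter $\mathcal{U}$ on $\mathbb{N}$ is metrically Ramsey if for every isometric coloring $\chi$ of $[\mathbb{N}]^2$ there is $U\in\mathcal{U}$ such that $[U]^2$ is $\chi$-monochrome. *)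

(* Defs.v *)
From HB Require Import structures.
From mathcomp Require Import all_boot all_order all_algebra finmap.
From mathcomp Require Import mathcomp_extra boolp classical_sets filter.

Set Implicit Arguments.
Unset Strict Implicit.
Unset Printing Implicit Defensive.

Local Open Scope nat_scope.
Local Open Scope classical_set_scope.

(* The natural numbers {1, 2, 3, ...}: zero is excluded. *)
Record posN := PosN { posN_val :> nat; posN_gt0 : 0 < posN_val }.

HB.instance Definition _ := [isSub for posN_val].
HB.instance Definition _ := [Countable of posN by <:].

Definition addp (m n : posN) : posN := PosN (ltn_addr n (posN_gt0 m)).

Lemma double_posN_gt0 (n : posN) : 0 < n.*2.
Proof. by rewrite double_gt0 posN_gt0. Qed.

Definition doublep (n : posN) : posN := PosN (double_posN_gt0 n).

(* `|m - n|%N is the absolute value of the difference taken in int, not a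
   truncated subtraction. *)
Definition distp (m n : posN) : nat := `|m - n|%N.

(* [T]^2, the set of two-element subsets of T. *)
Definition two_subset (T : choiceType) := {A : {fset T} | #|` A| == 2}.

Lemma card_two_subset (T : choiceType) (x y : T) (xy : x != y) :
  #|` [fset x; y]%fset| == 2.
Proof. by rewrite cardfs2 xy. Qed.

Definition pair_of (T : choiceType) (x y : T) (xy : x != y) : two_subset T :=
  exist (fun A : {fset T} => #|` A| == 2) [fset x; y]%fset (card_two_subset xy).

Definition isometric_coloring (chi : two_subset posN -> bool) : Prop :=
  forall (x y z t : posN) (xy : x != y) (zt : z != t),
    distp x y = distp z t -> chi (pair_of xy) = chi (pair_of zt).

Definition monochrome (T : choiceType) (chi : two_subset T -> bool)
    (U : set T) : Prop :=
  forall A B : two_subset T,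
    [set` val A] `<=` U -> [set` val B] `<=` U -> chi A = chi B.

Definition free_ultrafilter (T : Type) (F : set_system T) : Prop :=
  UltraFilter F /\ forall x : T, F <> principal_filter x.

Definition metrically_ramsey (F : set_system posN) : Prop :=
  free_ultrafilter F /\
  forall chi : two_subset posN -> bool, isometric_coloring chi ->
    exists2 U : set posN, F U & monochrome chi U.

(* Main.v *)
(** A coloring of pairs that depends only on distances is a coloring [c] of the
    positive integers, and it separates [{a, a + x}] from [{a, a + f x}] as soon
    as [c x <> c (f x)].  Such a [c] exists because the graph with edges
    [{x, f x}] is a forest: color [x] by the parity of its graph distance to a
    fixed representative of its component. *)
Require Import Defs.
From mathcomp Require Import all_boot all_order all_algebra finmap.
From mathcomp Require Import mathcomp_extra boolp classical_sets filter.
From mathcomp Require Import zify.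

Set Implicit Arguments.
Unset Strict Implicit.
Unset Printing Implicit Defensive.

Local Open Scope nat_scope.
Local Open Scope classical_set_scope.

(** If two iterates coincided, the earlier one would be a periodic point. *)
Lemma iter_acyclic_inj (T : Type) (f : T -> T) :
  (forall n x, iter n.+1 f x <> x) ->
  forall x, injective (fun n => iter n f x).
Proof.
move=> acyclic x m n /=.
wlog mn : m n / m < n => [wl emn|emn].
  case: (ltngtP m n) => // [mn|nm]; first exact: wl.
  by apply/esym/wl.
case: (acyclic (n - m).-1 (iter m f x)).
rewrite -iterD [in RHS]emn; congr (iter _ f x); lia.
Qed.

Lemma acyclic_two_coloring (T : choiceType) (f : T -> T) :
  (forall n x, iter n.+1 f x <> x) ->
  exists c : T -> bool, forall x, c (f x) = ~~ c x.
Proof.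
move=> acyclic.
(* Edges come from a function, so two points are connected exactly when their forward orbits
   meet. *)
pose comp x y := `[< exists m n, iter m f x = iter n f y >].
have comp_f x : comp (f x) =1 comp x.
  move=> y; apply/asboolP/asboolP => -[m [n e]].
    by exists m.+1, n; rewrite iterSr.
  by exists m, n.+1; rewrite -iterSr !iterS e.
have comp_ex x : exists y, comp x y by exists x; apply/asboolP; exists 0, 0.
pose rep x := xchoose (comp_ex x).
(* [xchoose] depends only on the extension of the predicate, so neighbours get the very same
   representative. *)
have rep_f x : rep (f x) = rep x by exact/eq_xchoose/comp_f.
(* Any two meetings of the orbits of [x] and [y] have the same offset: applying [f] further to each
   equation gives [m' + n = m + n']. *)
have parity x y m n m' n' : iter m f x = iter n f y ->
    iter m' f x = iter n' f y -> odd (m + n) = odd (m' + n').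
  move=> e e'.
  have : iter (m' + n) f y = iter (m + n') f y.
    by rewrite !iterD -e -e' -!iterD addnC.
  by move=> /(iter_acyclic_inj acyclic) en; lia.
exists (fun x => `[< exists m n,
  iter m f x = iter n f (rep x) /\ odd (m + n) >]) => x.
have /asboolP[m [n e]] := xchooseP (comp_ex (f x)).
rewrite -/(rep _) in e.
transitivity (odd (m + n)).
  apply/asboolP/idP => [[m' [n' [e']]]|]; last by exists m, n.
  by rewrite (parity _ _ _ _ _ _ e e').
(* A meeting [(m, n)] for [f x] is a meeting [(m.+1, n)] for [x]: the edge from [x] to [f x] flips
   the parity. *)
rewrite -[LHS]negbK -oddS -addSn; congr negb.
rewrite rep_f -iterSr in e.
apply/idP/asboolP => [|[m' [n' [e']]]]; first by exists m.+1, n.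
by rewrite (parity _ _ _ _ _ _ e e').
Qed.

Lemma increasing_acyclic (T : Type) (h : T -> nat) (f : T -> T) :
  (forall x, h x < h (f x)) -> forall n x, iter n.+1 f x <> x.
Proof.
move=> hf n x e; suff : h x < h (iter n.+1 f x) by rewrite e ltnn.
by elim: n {e} => [|n IHn] //; apply: ltn_trans (hf _).
Qed.

Lemma isometric_coloring_of_distances (c : posN -> bool) :
  exists2 chi, isometric_coloring chi &
    forall (x d : posN) (xd : x != addp x d), chi (pair_of xd) = c d.
Proof.
(* Quantifying over members avoids ordering the pair; [d] being positive forces [x] and [y] to be
   its two distinct elements. *)
pose chi (A : two_subset posN) := `[< exists x y d : posN,
  [/\ x \in val A, y \in val A, distp x y = d & c d] >].
have chiE (x y d : posN) (xy : x != y) : distp x y = d -> chi (pair_of xy) = c d.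
  move=> xyd; apply/asboolP/idP => [[x' [y' [d' []]]]|cd].
    rewrite !inE => x'xy y'xy x'y'd'; suff -> : d' = d by [].
    apply: val_inj; rewrite /= -x'y'd' -xyd.
    have := posN_gt0 d'; rewrite -x'y'd' /distp.
    by case/orP: x'xy => /eqP->; case/orP: y'xy => /eqP->; lia.
  by exists x, y, d; split; rewrite // !inE eqxx ?orbT.
exists chi => [x y z t xy zt xyzt|x d xd]; last first.
  by apply: chiE; rewrite /distp /=; lia.
have xy_gt0 : 0 < distp x y.
  by move: xy; rewrite -val_eqE /distp /=; lia.
by rewrite (chiE _ _ (PosN xy_gt0)) // (chiE _ _ (PosN xy_gt0)).
Qed.

Lemma metrically_ramsey_avoids (F : set_system posN) (f : posN -> posN) :
  metrically_ramsey F -> (forall x : posN, x < f x) ->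
  exists2 U : set posN, F U &
    forall a x : posN, ~ ([set a; addp a x; addp a (f x)] `<=` U).
Proof.
move=> [_ ramseyF] f_gt.
have [c cf] := acyclic_two_coloring (increasing_acyclic f_gt).
have [chi /ramseyF[U FU monoU] chiE] := isometric_coloring_of_distances c.
exists U => // a x subU.
have neq d : a != addp a d.
  by rewrite -val_eqE /=; have := posN_gt0 d; lia.
have pairU d : U a -> U (addp a d) -> [set` val (pair_of (neq d))] `<=` U.
  by move=> Ua Ud y; rewrite /= !inE => /orP[] /eqP->.
(* The pairs [{a, a + x}] and [{a, a + f x}] both lie in [U], so [chi] agrees on them, against
   [cf]. *)
have : c x = c (f x).
  rewrite -(chiE a x (neq x)) -(chiE a (f x) (neq (f x))).
  by apply: monoU; apply: pairU; apply: subU; rewrite /=; tauto.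
by rewrite cf; case: (c x).
Qed.

Theorem proposition3p1 :
  (forall (F : set_system posN) (f : posN -> posN),
     metrically_ramsey F ->
     (forall x : posN, x < f x) ->
     exists2 U : set posN, F U &
       forall a x : posN, ~ ([set a; addp a x; addp a (f x)] `<=` U)) /\
  (forall F : set_system posN,
     metrically_ramsey F ->
     exists2 U : set posN, F U &
       forall a x : posN, ~ ([set a; addp a x; addp a (doublep x)] `<=` U)).
Proof.
split=> [|F ramseyF]; first exact: metrically_ramsey_avoids.
apply: metrically_ramsey_avoids => // x.
by rewrite /= -addnn -[X in X < _]addn0 ltn_add2l posN_gt0.
Qed.
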